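(* The system $(\Sigma_N^{\mathbb{Z}},\Pi_{p/q,N})$ is not regular for any coprime integers $p,q>2$ and any $N\in\mathbb{Z}_+$ such that the map $\Pi_{p/q,N}$ is defined.
   Context: $\Sigma_N=\{0,\dots,N-1\}$; $\Sigma_N^{\mathbb{Z}}$ has the prodiscrete topology. **Multiplication automata.** For $p$ dividing $N$ with $N=pq$, $\Pi_{p,N}:\Sigma_N^{\mathbb{Z}}\to\Sigma_N^{\mathbb{Z}}$ is $\Pi_{p,N}(x)[i]=g_{p,N}(x[i],x[i+1])$, where $g_{p,N}(a_1q+a_0,b_1q+b_0)=a_0p+b_1$ for $a_0,b_0\in\Sigma_q$, $a_1,b_1\in\Sigma_p$. These maps are bijective and commute. If $\alpha=p/q$ with $p=\prod p_i$, $q=\prod q_j$ products of positive divisors $p_i,q_j$ of $N$, then $\Pi_{\alpha,N}$ is the composition of the maps $\Pi_{p_i,N}$ and $\Pi_{q_j,N}^{-1}$ (independent of the decomposition). $\Pi_{\alpha,N}$ is ''defined'' exactly for such $\alpha$. **Regularity.** A dynamical system $(X,T)$ is a compact metrizable space with a continuous self-map; $(Y,S)$ is a factor of $(X,T)$ if there is a continuous surjection $\psi:X\to Y$ with $\psi\circ T=S\circ\psi$. A one-sided subshift is a system $(Y,\sigma)$ with $Y\subseteq\Sigma^{\mathbb{N}}$ closed ($\Sigma$ a finite alphabet), $\sigma(Y)\subseteq Y$, where $\sigma(x)[i]=x[i+1]$. A subshift is sofic if it is a factor of a subshift of finite type. A dynamical system $(X,T)$ with $X$ a zero-dimensional compact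 metrizable space is called regular if all its one-sided subshift factors are sofic. *)

(* Defs.v *)
From mathcomp Require Import all_boot all_order all_algebra.
From mathcomp Require Import all_classical all_reals topology.

Set Implicit Arguments.
Unset Strict Implicit.
Unset Printing Implicit Defensive.

Import Order.TTheory GRing.Theory Num.Theory.

Local Open Scope classical_set_scope.
Local Open Scope ring_scope.

Definition is_metric (R : realType) (X : Type) (d : X -> X -> R) : Prop :=
  [/\ forall x y, 0 <= d x y,
      forall x y, d x y = 0 <-> x = y,
      forall x y, d x y = d y x &
      forall x y z, d x z <= d x y + d y z].

(* All [realType]s are isomorphic, so quantifying over them is only a way of
   not fixing a model of the real numbers. *)
Definition metrizable (X : topologicalType) : Prop :=
  forall R : realType, exists2 d : X -> X -> R, is_metric d &
    forall (x : X) (U : set X),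
      nbhs x U <-> exists2 e : R, 0 < e & [set y | d x y < e] `<=` U.

Record system := System {
  space :> topologicalType;
  step : space -> space;
  system_compact : compact [set: space];
  system_metrizable : metrizable space;
  step_continuous : continuous step }.
Arguments step : clear implicits.

Definition factor_of (Y X : system) : Prop :=
  exists psi : X -> Y,
    [/\ continuous psi, range psi = [set: Y] &
        forall x, psi (step X x) = step Y (psi x)].

(* [zero_dimensional] separates points by clopen sets, which on a compact
   metrizable space amounts to having a basis of clopen sets. *)
Record zd_system := ZDSystem {
  zd_base :> system;
  zd_zero_dimensional : zero_dimensional zd_base }.

Section AgreementMetric.
Context {R : realType} {X : topologicalType} {D : eqType} (c : nat -> X -> D).
Hypothesis c_sep : forall x y, (forall k, c k x = c k y) -> x = y.
Hypothesis c_nbhs : forall (x : X) (U : set X), nbhs x U <->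
  exists n, forall y, (forall k, (k < n)%N -> c k x = c k y) -> U y.

Let adist (x y : X) : R :=
  match pselect (exists k, c k x != c k y) with
  | left h => (ex_minn h).+1%:R^-1
  | right _ => 0
  end.

Let adist_lt x y m :
  adist x y < m.+1%:R^-1 <-> forall k, (k <= m)%N -> c k x = c k y.
Proof.
rewrite /adist; case: pselect => [h|h].
  case: ex_minnP => n cn mn; rewrite ltf_pV2 ?posrE ?ltr0n// ltr_nat ltnS.
  split=> [mn' k km|agr].
    apply/eqP; apply: contraT => /mn nk.
    by move: (leq_ltn_trans km mn'); rewrite ltnNge nk.
  by rewrite ltnNge; apply: contra cn => /agr ->.
split=> [_ k _|_]; last by rewrite invr_gt0 ltr0n.
by apply/eqP; apply: contraT => ck; case: h; exists k.
Qed.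

Let adist_case x y : adist x y = 0 \/ exists m, adist x y = m.+1%:R^-1.
Proof. by rewrite /adist; case: pselect => h; [right; eexists|left]. Qed.

Let adist_ge0 x y : 0 <= adist x y.
Proof. by case: (adist_case x y) => [->|[m ->]]//; rewrite invr_ge0 ler0n. Qed.

Let adist_le x y z :
  (forall k, c k x = c k y -> c k y = c k z -> c k x = c k z) ->
  adist x z <= adist x y + adist y z.
Proof.
move=> tr; rewrite leNgt; apply/negP => lt.
case: (adist_case x z) => [xz|[m xz]].
  by move: lt; rewrite xz ltNge addr_ge0.
have xy : adist x y < m.+1%:R^-1.
  by rewrite -xz; apply: le_lt_trans lt; rewrite lerDl.
have yz : adist y z < m.+1%:R^-1.
  by rewrite -xz; apply: le_lt_trans lt; rewrite lerDr.
have : adist x z < m.+1%:R^-1.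
  apply/adist_lt => k km.
  by apply: tr; [exact: (adist_lt x y m).1 km|exact: (adist_lt y z m).1 km].
by rewrite xz ltxx.
Qed.

Let adist_sym_le x y : adist x y <= adist y x.
Proof.
rewrite leNgt; apply/negP => lt.
case: (adist_case x y) => [xy|[m xy]].
  by move: lt; rewrite xy ltNge adist_ge0.
have : adist x y < m.+1%:R^-1.
  apply/adist_lt => k km; apply/esym.
  by apply: (adist_lt y x m).1 km; rewrite -xy.
by rewrite xy ltxx.
Qed.

Lemma agreement_metric : exists2 d : X -> X -> R, is_metric d &
  forall (x : X) (U : set X),
    nbhs x U <-> exists2 e : R, 0 < e & [set y | d x y < e] `<=` U.
Proof.
exists adist.
  split.
  - exact: adist_ge0.
  - move=> x y; split=> [xy|->].
      apply: c_sep => k; apply: (adist_lt x y k).1 (leqnn k).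
      by rewrite xy invr_gt0 ltr0n.
    rewrite /adist; case: pselect => // h; exfalso.
    by case: h => k; rewrite eqxx.
  - by move=> x y; apply/eqP; rewrite eq_le !adist_sym_le.
  - by move=> x y z; apply: adist_le => k -> ->.
move=> x U; rewrite c_nbhs; split=> [[n nU]|[e e0 eU]].
  exists n.+1%:R^-1; first by rewrite invr_gt0 ltr0n.
  by move=> y /= /adist_lt xy; apply: nU => k /ltnW; exact: xy.
have [n ne] : exists n, n.+1%:R^-1 < e.
  have [n] := ltr_add_invr (e0 : 0 < e); rewrite add0r => ne.
  by exists n.
exists n.+1 => y xy; apply: eU => /=; apply: lt_trans ne.
by apply/adist_lt => k km; exact: xy.
Qed.

End AgreementMetric.

Section DiscreteProduct.
Context {I : countType} {A : finType}.
Local Notation X := (prod_topology (fun _ : I => discrete_topology A)).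

Let coord (k : nat) (x : X) : option A := omap x (unpickle k).

Let coord_pickle (x : X) i : coord (pickle i) x = Some (x i).
Proof. by rewrite /coord pickleK. Qed.

Lemma prod_nbhs1 (x : X) i : nbhs x [set y : X | x i = y i].
Proof.
have h := @proj_continuous I (fun _ => discrete_topology A) i x.
by apply: (h [set a | x i = a]); exact/principal_filterP.
Qed.

Lemma prod_nbhsP (x : X) (U : set X) : nbhs x U <->
  exists n, forall y : X, (forall k, (k < n)%N -> coord k x = coord k y) -> U y.
Proof.
split=> [xU|[n nU]]; last first.
  apply: filterS nU _; elim: n => [|n ih]; first exact: filterS filterT.
  have xn : nbhs x [set y : X | coord n x = coord n y].
    rewrite /coord; case: unpickle => [i|] /=; last exact: filterS filterT.
    by apply: filterS (prod_nbhs1 x i) => y /= ->.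
  apply: filterS2 ih xn => y agr yn k.
  by rewrite ltnS leq_eqVlt => /predU1P[->//|]; exact: agr.
pose F := filter_from [set: nat]
  (fun n => [set y : X | forall k, (k < n)%N -> coord k x = coord k y]).
have FF : Filter F.
  apply: filter_from_filter; first by exists 0%N.
  move=> m n _ _; exists (maxn m n) => // y agr.
  by split=> k km; apply: agr; rewrite leq_max km ?orbT.
suff /(_ U xU) [n _ nU] : F --> x by exists n.
apply/cvg_sup => i V [W [[B _ <-]] /= Bx BV].
exists (pickle i).+1 => // y /(_ (pickle i) (ltnSn _)).
by rewrite !coord_pickle => -[xy]; apply: BV; rewrite /= -xy.
Qed.

Let coord_sep (x y : X) : (forall k, coord k x = coord k y) -> x = y.
Proof.
by move=> xy; apply/funext => i; have := xy (pickle i);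
  rewrite !coord_pickle => -[].
Qed.

Lemma prod_compact : compact [set: X].
Proof.
have fc (i : I) : compact [set: discrete_topology A].
  by apply: finite_compact; exact: (@finite_finset A).
have := @tychonoff I (fun _ => discrete_topology A) _ fc.
by congr (compact _); rewrite eqEsubset.
Qed.

Lemma prod_metrizable : metrizable X.
Proof. by move=> R; exact: agreement_metric coord_sep prod_nbhsP. Qed.

Lemma prod_zero_dimensional : zero_dimensional X.
Proof. by apply: zero_dimension_prod => _; exact: discrete_zero_dimension. Qed.

Lemma prod_continuous (f : X -> X) :
  (forall i, exists s : seq I, forall x y : X,
     (forall j, j \in s -> x j = y j) -> f x i = f y i) ->
  continuous f.
Proof.
move=> loc x; have fF : Filter (f @ nbhs x) by exact: fmap_filter.
apply/cvg_sup => i V [W [[B _ <-]] /= Bx BV].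
have [s sP] := loc i.
have xs : nbhs x [set y : X | forall j, j \in s -> x j = y j].
  elim: s {sP} => [|j s ih]; first exact: filterS filterT.
  apply: filterS2 (prod_nbhs1 x j) ih => y /= xj xs l.
  by rewrite inE => /predU1P[->//|]; exact: xs.
by apply: filterS xs => y /sP xy; apply: BV; rewrite /= -xy.
Qed.

Section Subspace.
Context (Y : set X).

Lemma sub_nbhsP (x : Y) (U : set Y) : nbhs x U <->
  exists2 V : set X, nbhs (set_val x) V & set_val @^-1` V `<=` U.
Proof.
split=> [[W [[B oB <-]] /= Bx BU]|[V xV VU]].
  by exists B => //; exact: open_nbhs_nbhs.
by apply: filterS VU _; exact: (@initial_continuous _ _ set_val).
Qed.

Lemma sub_metrizable : metrizable Y.
Proof.
move=> R; apply: (@agreement_metric R Y _ (fun k x => coord k (set_val x))).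
  by move=> x y xy; apply: val_inj; exact: coord_sep xy.
move=> x U; rewrite sub_nbhsP; split=> [[V /prod_nbhsP[n nV] VU]|[n nU]].
  by exists n => y xy; apply: VU; exact: nV.
exists [set y : X | forall k, (k < n)%N -> coord k (set_val x) = coord k y].
  by apply/prod_nbhsP; exists n.
by move=> y; exact: nU.
Qed.

Lemma sub_compact : closed Y -> compact [set: Y].
Proof.
move=> cY F PF _.
have cptY : compact Y by apply: (subclosed_compact cY prod_compact).
have [|p [Yp Fp]] := cptY (set_val @ F).
  by apply: (@filterS _ F _ setT) => [y _|]; [exact: set_valP|exact: filterT].
exists (SigSub (mem_set Yp)); split=> // G U FG /sub_nbhsP[V pV VU].
have [|z [[y Gy <-] Vy]] := Fp (set_val @` G) V _ pV.
  by apply: (@filterS _ F _ G) => [y Gy|//]; exists y.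
by exists y; split=> //; exact: VU.
Qed.

End Subspace.
End DiscreteProduct.

Definition fullshift (A : finType) : topologicalType :=
  prod_topology (fun _ : nat => discrete_topology A).

Definition left_shift (A : finType) (x : fullshift A) : fullshift A :=
  fun i => x i.+1.

Record subshift (A : finType) := Subshift {
  points :> set (fullshift A);
  points_closed : closed points;
  points_shift : @left_shift A @` points `<=` points }.

Section SubshiftSystem.
Context (A : finType) (Y : subshift A).

Definition subshift_step (x : points Y) : points Y :=
  SigSub (mem_set (points_shift (imageP (@left_shift A) (set_valP x)))).

Lemma subshift_step_continuous : continuous subshift_step.
Proof.
apply: continuous_comp_initial => x.
apply: (@continuous_comp _ _ _ set_val (@left_shift A)).
  exact: (@initial_continuous _ _ set_val).
apply: prod_continuous => i; exists [:: i.+1] => y z; apply.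
by rewrite inE.
Qed.

Definition subshift_system : system :=
  System (sub_compact (@points_closed A Y)) (@sub_metrizable nat A Y)
    subshift_step_continuous.

End SubshiftSystem.
Coercion subshift_system : subshift >-> system.

Definition occurs (A : finType) (w : seq A) (x : fullshift A) : Prop :=
  exists i : nat, w = mkseq (fun k => x (i + k)%N) (size w).

Definition finite_type (A : finType) (Y : subshift A) : Prop :=
  exists F : seq (seq A),
    points Y = [set x | forall w, w \in F -> ~ occurs w x].

Definition sofic (A : finType) (Y : subshift A) : Prop :=
  exists (B : finType) (Z : subshift B), finite_type Z /\ factor_of Y Z.

Definition regular (X : zd_system) : Prop :=
  forall (A : finType) (Y : subshift A), factor_of Y X -> sofic Y.

Definition config (N : nat) : topologicalType :=
  prod_topology (fun _ : int => discrete_topology 'I_N).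

(* With [q = N / p], [a = a1 q + a0] and [b = b1 q + b0], the result is
   [a0 p + b1].  The default value of [insubd] is never used when [p]
   divides [N], see [val_mul_rule]. *)
Definition mul_rule (p N : nat) (a b : 'I_N) : 'I_N :=
  insubd a ((a %% (N %/ p)) * p + b %/ (N %/ p))%N.

Definition Pi (p N : nat) (x : config N) : config N :=
  fun i => mul_rule p (x i) (x (i + 1)).

(* The inverse of [Pi p] when [p] divides [N], see [Pi_bijective]. *)
Definition Pi_inv (p N : nat) (y : config N) : config N :=
  xget y [set x | Pi p x = y].

Lemma codivisor_gt0 (N p : nat) :
  (0 < N)%N -> (p %| N)%N -> (0 < N %/ p)%N.
Proof.
by move=> N0 pN; rewrite divn_gt0; [exact: dvdn_leq|exact: dvdn_gt0 pN].
Qed.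

Lemma mul_rule_lt (q p a b : nat) : (0 < q)%N -> (b < q * p)%N ->
  ((a %% q) * p + b %/ q < q * p)%N.
Proof.
move=> q0 bqp; apply: (@leq_trans ((a %% q).+1 * p)).
  by rewrite mulSn addnC ltn_add2r ltn_divLR// mulnC.
by rewrite leq_mul2r ltn_mod q0 orbT.
Qed.

Lemma val_mul_rule (N p : nat) (a b : 'I_N) : (0 < N)%N -> (p %| N)%N ->
  mul_rule p a b = ((a %% (N %/ p)) * p + b %/ (N %/ p))%N :> nat.
Proof.
move=> N0 pN; rewrite /mul_rule val_insubd ifT//.
rewrite -[X in (_ < X)%N](divnK pN); apply: mul_rule_lt.
  exact: codivisor_gt0.
by rewrite divnK.
Qed.

Lemma Pi_codivisor (N p : nat) (x : config N) :
  (0 < N)%N -> (p %| N)%N -> Pi (N %/ p) (Pi p x) = fun i => x (i + 1).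
Proof.
move=> N0 pN; have p0 := dvdn_gt0 N0 pN.
have q0 := codivisor_gt0 N0 pN.
have qN : (N %/ p %| N)%N by exact: dvdn_div.
apply/funext => i; apply: val_inj; rewrite /= /Pi.
rewrite (val_mul_rule _ _ N0 qN) !(val_mul_rule _ _ N0 pN).
have -> : (N %/ (N %/ p) = p)%N by rewrite divnA// mulKn.
have lt_p (b : 'I_N) : (b %/ (N %/ p) < p)%N.
  by rewrite ltn_divLR// mulnC divnK.
rewrite modnMDl (modn_small (lt_p _)) divnMDl// (divn_small (lt_p _)) addn0.
by rewrite -divn_eq.
Qed.

Lemma Pi_invE (N p : nat) (y : config N) : (0 < N)%N -> (p %| N)%N ->
  Pi_inv p y = fun i => Pi (N %/ p) y (i - 1).
Proof.
move=> N0 pN; have p0 := dvdn_gt0 N0 pN.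
have q0 := codivisor_gt0 N0 pN.
have qN : (N %/ p %| N)%N by exact: dvdn_div.
have qq : (N %/ (N %/ p) = p)%N by rewrite divnA// mulKn.
rewrite /Pi_inv; case: xgetP => [x _ <-|/(_ (fun i => Pi (N %/ p) y (i - 1)))[]].
  by rewrite Pi_codivisor//; apply/funext => i /=; rewrite subrK.
have := Pi_codivisor y N0 qN; rewrite qq => yE.
apply/funext => i; have := congr1 (fun z : config N => z (i - 1)) yE.
by rewrite /= subrK => <-; rewrite /Pi subrK addrK.
Qed.

Lemma Pi_bijective (N p : nat) : (0 < N)%N -> (p %| N)%N ->
  cancel (@Pi p N) (@Pi_inv p N) /\ cancel (@Pi_inv p N) (@Pi p N).
Proof.
move=> N0 pN; have p0 := dvdn_gt0 N0 pN.
have q0 := codivisor_gt0 N0 pN.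
have qN : (N %/ p %| N)%N by exact: dvdn_div.
have qq : (N %/ (N %/ p) = p)%N by rewrite divnA// mulKn.
split=> [x|y].
  by rewrite Pi_invE// Pi_codivisor//; apply/funext => i /=; rewrite subrK.
rewrite Pi_invE//; have := Pi_codivisor y N0 qN; rewrite qq => yE.
apply/funext => i; have := congr1 (fun z : config N => z (i - 1)) yE.
by rewrite /= subrK => <-; rewrite /Pi subrK addrK.
Qed.

Lemma Pi_continuous (N p : nat) : continuous (@Pi p N).
Proof.
apply: prod_continuous => i; exists [:: i; i + 1] => x y xy.
by rewrite /Pi !xy// !inE eqxx ?orbT.
Qed.

Lemma Pi_inv_continuous (N p : nat) : (0 < N)%N -> (p %| N)%N ->
  continuous (@Pi_inv p N).
Proof.
move=> N0 pN; apply: prod_continuous => i.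
exists [:: i - 1; i] => x y xy; rewrite !Pi_invE// /Pi.
by rewrite subrK !xy// !inE eqxx ?orbT.
Qed.

(* [T] is a composition witnessing that the automaton of the rational [a] over
   the alphabet of size [N] is defined; such a [T] depends only on [a] and [N],
   and it exists exactly when [a] is a quotient of products of divisors of
   [N]. *)
Definition is_Pi (a : rat) (N : nat) (T : config N -> config N) : Prop :=
  exists ps qs : seq nat,
    [/\ all (fun r => (0 < r)%N && (r %| N)%N) (ps ++ qs),
        a = (\prod_(r <- ps) r)%N%:R / (\prod_(r <- qs) r)%N%:R &
        T = foldr (fun r f => @Pi r N \o f)
              (foldr (fun r f => @Pi_inv r N \o f) id qs) ps].

Section PiSystem.
Context (a : rat) (N : nat) (T : config N -> config N).
Context (N_gt0 : (0 < N)%N) (aT : is_Pi a T).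

Lemma is_Pi_continuous : continuous T.
Proof.
case: aT => ps [qs [+ _ ->]]; rewrite all_cat => /andP[psN qsN].
elim: ps psN => [_|r ps ih] /=; last first.
  case/andP=> _ /ih cf x; apply: continuous_comp; first exact: cf.
  exact: Pi_continuous.
elim: qs qsN => [_|r qs ih] /=; first by move=> x; exact: cvg_id.
case/andP=> /andP[_ rN] /ih cf x; apply: continuous_comp; first exact: cf.
exact: Pi_inv_continuous.
Qed.

Definition Pi_system : zd_system :=
  ZDSystem (zd_base := System prod_compact prod_metrizable is_Pi_continuous)
    prod_zero_dimensional.

End PiSystem.

(* Main.v *)
(* Write [u x] for the number in [0, 1] with base-[N] digits x[1], x[2], ...
   For suitable [a] and [b] with [a / b = p / q], the number
   [b * u (T x) - a * u x] is an integer depending on finitely many digits of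
   [x]; the traces of this integer form a subshift factor.  If it were sofic,
   then among any [K + 1] of its points, cut at a common time, two could exchange
   their futures.

   Take points passing at the cut through the iterates [T^i] (if [p > q]) or
   [T^-i] (if [p < q]) of the configuration of the number 1.  If [z] has the past
   of the [i]-th and the future of the [j]-th, then its [u] differs from theirs by
   an error which is multiplied by [p / q] at each step.  On the side of the cut
   where the error expands, its boundedness makes it negligible at the cut; on
   the other side it is nonnegative, as it is so at the time when the point
   compared with passes through 1, where [u] vanishes.  Exchanging futures both
   ways forces [(p / q)^i] and [(p / q)^j] (or [(q / p)^i] and [(q / p)^j]) to
   have equal fractional parts, which coprimality forbids. *)

Require Import Defs.
From mathcomp Require Import all_boot all_order all_algebra.
From mathcomp Require Import all_classical all_reals topology.
From mathcomp Require Import ring lra zify Rstruct.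

Set Implicit Arguments.
Unset Strict Implicit.
Unset Printing Implicit Defensive.

Import Order.TTheory GRing.Theory Num.Theory.

Local Open Scope classical_set_scope.
Local Open Scope ring_scope.

(** * Trace subshifts and sofic subshifts *)

Definition trace (X : system) (A : finType) (c : X -> A) (x : X) :
    fullshift A := fun k => c (iter k (step X) x).

Lemma iter_step_continuous (X : system) k : continuous (iter k (step X)).
Proof.
elim: k => [|k ih] x /=; first exact: cvg_id.
by apply: continuous_comp; [exact: ih|exact: step_continuous].
Qed.

Lemma near_trace (X : system) (A : finType) (c : X -> A) (x : X) k :
  (forall y : X, \forall z \near y, c z = c y) ->
  \forall z \near x, trace c z k = trace c x k.
Proof.
by move=> cP; exact: (@iter_step_continuous X k x [set z | c z = _] (cP _)).
Qed.

Lemma trace_continuous (X : system) (A : finType) (c : X -> A) :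
  (forall x : X, \forall y \near x, c y = c x) -> continuous (trace c).
Proof.
move=> cP x; have fF : Filter (trace c @ nbhs x) by exact: fmap_filter.
apply/cvg_sup => i V [W [[B _ <-]] /= Bx BV].
apply: filterS (near_trace x i cP) => y yx; apply: BV => /=.
by rewrite yx.
Qed.

Lemma fullshift_hausdorff (A : finType) : hausdorff_space (fullshift A).
Proof. by apply: hausdorff_product => _; exact: discrete_hausdorff. Qed.

(** A locally constant code has a continuous trace map, which serves as the factor map; its range is
    closed, being the image of a compact space in a Hausdorff one. *)
Lemma trace_subshift (X : system) (A : finType) (c : X -> A) :
  (forall x : X, \forall y \near x, c y = c x) ->
  exists2 Y : subshift A, factor_of Y X & points Y = range (trace c).
Proof.
move=> cP; have tc := trace_continuous cP.
have clY : closed (range (trace c)).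
  apply: (compact_closed (@fullshift_hausdorff A)).
  apply: continuous_compact (@system_compact X).
  by apply: continuous_subspaceT.
have stepE x : left_shift (trace c x) = trace c (step X x).
  by apply/funext => k; rewrite /left_shift /trace iterSr.
have shY : @left_shift A @` range (trace c) `<=` range (trace c).
  by move=> _ [_ [x _ <-] <-]; exists (step X x).
exists (Subshift clY shY) => //.
exists (fun x => SigSub (mem_set (imageT (trace c) x))); split=> /=.
- exact: continuous_comp_initial.
- apply/seteqP; split=> // y _; case: (set_valP y) => x _ xy.
  by exists x => //; apply: val_inj.
- by move=> x; apply: val_inj => /=; rewrite stepE.
Qed.

Lemma val_iter_step (B : finType) (Z : subshift B) (z : points Z) k i :
  set_val (iter k (step Z) z) i = set_val z (k + i)%N.
Proof. by elim: k i => // k ih i; rewrite iterS [LHS]ih addnS. Qed.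

Lemma window_nbhs (B : finType) (Z : subshift B) (z : points Z)
    (U : set (points Z)) : nbhs z U ->
  exists n, forall z' : points Z,
    (forall k, (k < n)%N -> set_val z k = set_val z' k) -> U z'.
Proof.
move=> /sub_nbhsP[V /prod_nbhsP[n nV] VU].
exists n => z' zz'; apply: VU; apply: nV => k kn.
by congr Some; exact: zz'.
Qed.

(** Continuity gives each point a window that determines the first symbol of its image; compactness
    of [Z] makes the length uniform. *)
Lemma factor_window (A B : finType) (Y : subshift A) (Z : subshift B)
    (psi : points Z -> points Y) : continuous psi ->
  exists r, forall z z' : points Z,
    (forall k, (k < r)%N -> set_val z k = set_val z' k) ->
    set_val (psi z) 0%N = set_val (psi z') 0%N.
Proof.
move=> cpsi.
have := (compact_near_coveringP [set: points Z]).1 (@system_compact Z) nat \oo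
  (fun r z => forall z' : points Z,
    (forall k, (k < r)%N -> set_val z k = set_val z' k) ->
    set_val (psi z) 0%N = set_val (psi z') 0%N) _.
case=> [z _|r _ /(_ r (leqnn r)) rP]; last by exists r => z z'; exact: rP.
have /window_nbhs[n nP] :
    nbhs z [set z' | set_val (psi z) 0%N = set_val (psi z') 0%N].
  apply: (cpsi z [set y | set_val (psi z) 0%N = set_val y 0%N]).
  by apply/sub_nbhsP; eexists; [exact: (prod_nbhs1 _ 0%N)|].
exists ([set z' : points Z | forall k, (k < n)%N -> set_val z k = set_val z' k],
        [set r | (n <= r)%N]) => /=.
  split; last by exists n.
  apply/sub_nbhsP.
  exists [set y | forall k, (k < n)%N -> set_val z k = y k] => //.
  by apply/prod_nbhsP; exists n => y xy k /xy[].
move=> [y r] /= [zy nr] z' yz'.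
rewrite -(nP y zy); apply: nP => k kn; rewrite zy// yz'//.
exact: leq_trans nr.
Qed.

Definition splice (A : finType) (n : nat) (x y : fullshift A) : fullshift A :=
  fun k => if (k < n)%N then x k else y k.

Lemma spliceL (A : finType) n r (x y : fullshift A) k :
  (forall i, (i < r)%N -> x (n + i)%N = y (n + i)%N) ->
  (k < n + r)%N -> splice n x y k = x k.
Proof.
move=> xy knr; rewrite /splice; case: ltnP => // nk.
by rewrite -(subnKC nk) xy// ltn_subLR.
Qed.

Lemma spliceR (A : finType) n (x y : fullshift A) k :
  (n <= k)%N -> splice n x y k = y k.
Proof. by rewrite /splice ltnNge => ->. Qed.

(** Take for [m] the maximal length of a forbidden word. One starting before the cut would end by
    [n + m], where the splice still agrees with [x]; one starting later would lie in [y]. *)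
Lemma finite_type_splice (B : finType) (Z : subshift B) : finite_type Z ->
  exists m, forall n x y, points Z x -> points Z y ->
    (forall i, (i < m)%N -> x (n + i)%N = y (n + i)%N) ->
    points Z (splice n x y).
Proof.
case=> F ZF; exists (\max_(w <- F) size w) => n x y; rewrite ZF /=.
move=> Zx Zy xy w wF [t wt].
have wm : (size w <= \max_(w <- F) size w)%N by exact: leq_bigmax_seq.
have [tn|nt] := ltnP t n.
  apply: (Zx _ wF); exists t; rewrite [LHS]wt; apply/eq_in_map => i.
  rewrite mem_iota /= => iw; apply: (spliceL xy).
  by apply: leq_trans (leq_add (ltnW tn) wm); rewrite ltn_add2l.
apply: (Zy _ wF); exists t; rewrite [LHS]wt; apply/eq_in_map => i _.
by rewrite spliceR// (leq_trans nt)// leq_addr.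
Qed.

(* The state reached in an SFT cover after reading [n] symbols is a word of
   bounded length, so among many points two share it, and then their futures
   can be exchanged. *)
Lemma sofic_splice (A : finType) (Y : subshift A) : sofic Y ->
  exists K, forall n (y : nat -> fullshift A), (forall i, points Y (y i)) ->
  exists i j, [/\ (i < j <= K)%N, points Y (splice n (y i) (y j)) &
                  points Y (splice n (y j) (y i))].
Proof.
case=> B [Z [/finite_type_splice[m mP] [psi [cpsi psiT psiS]]]].
have [r rP] := factor_window cpsi.
(* Agreement on [m] symbols allows splicing in [Z]; agreement on [r] symbols covers what the windows
   of [psi] starting before the cut see beyond it. *)
pose L := maxn m r.
have psi_iter k z : psi (iter k (step Z) z) = iter k (step Y) (psi z).
  by elim: k => //= k <-; rewrite psiS.
have local (z z' : points Z) k :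
    (forall i, (i < r)%N -> set_val z (k + i)%N = set_val z' (k + i)%N) ->
    set_val (psi z) k = set_val (psi z') k.
  move=> zz'; have := rP (iter k (step Z) z) (iter k (step Z) z').
  rewrite !psi_iter !val_iter_step addn0; apply=> i ir.
  by rewrite !val_iter_step zz'.
have psi_splice n (z z' : points Z) :
    (forall i, (i < L)%N -> set_val z (n + i)%N = set_val z' (n + i)%N) ->
    points Y (splice n (set_val (psi z)) (set_val (psi z'))).
  move=> zz'.
  have Zzz' : points Z (splice n (set_val z) (set_val z')).
    apply: mP; [exact: set_valP|exact: set_valP|].
    by move=> i im; apply: zz'; rewrite leq_max im.
  suff -> : splice n (set_val (psi z)) (set_val (psi z')) =
      set_val (psi (SigSub (mem_set Zzz'))) by exact: set_valP.
  apply/funext => k; rewrite {1}/splice; case: ltnP => kn;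
    apply: local => i ir /=.
    apply/esym/(spliceL zz').
    by rewrite -addnS leq_add// ?(ltnW kn)// leq_max ir orbT.
  by apply/esym/spliceR; rewrite (leq_trans kn)// leq_addr.
exists #|{ffun 'I_L -> B}| => n y Yy.
have zP i : exists z, set_val (psi z) = y i.
  have : range psi (SigSub (mem_set (Yy i))) by rewrite psiT.
  by case=> z _ zy; exists z; rewrite zy.
pose z i := projT1 (cid (zP i)).
have psiz i : set_val (psi (z i)) = y i := projT2 (cid (zP i)).
pose state (i : 'I_#|{ffun 'I_L -> B}|.+1) : {ffun 'I_L -> B} :=
  [ffun k : 'I_L => set_val (z i) (n + k)%N].
have [i [j [ij sij]]] : exists i j : 'I_#|{ffun 'I_L -> B}|.+1,
    (i < j)%N /\ state i = state j.
  apply: contrapT => nij.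
  have /leq_card : injective state.
    move=> i j sij; apply: val_inj; apply/eqP; apply: contrapT => /negP.
    by rewrite neq_ltn => /orP[] ij; apply: nij; [exists i, j|exists j, i].
  by rewrite card_ord ltnn.
have zij k : (k < L)%N -> set_val (z i) (n + k)%N = set_val (z j) (n + k)%N.
  by move=> kL; have /ffunP/(_ (Ordinal kL)) := sij; rewrite !ffunE.
exists i, j; split; first by rewrite ij -ltnS ltn_ord.
  by rewrite -!psiz; exact: psi_splice.
by rewrite -!psiz; apply: psi_splice => k kL; rewrite zij.
Qed.

(** * Fractional parts and multiplication *)

Section FractionalValue.
Context {R : realType} {N : nat}.
Implicit Types (x : config N) (r : nat).

Definition shift (m : int) x : config N := fun i => x (i + m).

Fixpoint partial_frac (n : nat) x : R :=
  if n is n'.+1 then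
    ((nat_of_ord (x 1))%:R + partial_frac n' (shift 1 x)) / N%:R
  else 0.

(** The truncations are nondecreasing, so the supremum is the value of the infinite expansion; it
    may equal 1. *)
Definition fractional_value x : R := sup (range (partial_frac ^~ x)).

Local Notation frac := fractional_value.

Context (N_gt1 : (1 < N)%N).

Let N_gt0 : 0 < N%:R :> R. Proof. by rewrite ltr0n (ltn_trans _ N_gt1). Qed.

Lemma partial_frac_ge0 n x : 0 <= partial_frac n x.
Proof. by elim: n x => //= n ih x; rewrite divr_ge0// addr_ge0. Qed.

Lemma partial_frac_le1 n x : partial_frac n x <= 1.
Proof.
elim: n x => //= n ih x; rewrite ler_pdivrMr// mul1r.
apply: (@le_trans _ _ ((nat_of_ord (x 1%R))%:R + 1)); first by rewrite lerD2l.
by rewrite natr1 ler_nat.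
Qed.

Let partial_has_sup x : has_sup (range (partial_frac ^~ x)).
Proof.
split; first by exists 0, 0%N.
by exists 1 => _ [n _ <-]; exact: partial_frac_le1.
Qed.

Let partial_le_frac n x : partial_frac n x <= frac x.
Proof. by apply: sup_ubound; [case: (partial_has_sup x)|exists n]. Qed.

Lemma frac_ge0 x : 0 <= frac x.
Proof. exact: (partial_le_frac 0). Qed.

Let frac_le x c : (forall n, partial_frac n x <= c) -> frac x <= c.
Proof.
by move=> h; apply: ge_sup => [|_ [n _ <-]//]; case: (partial_has_sup x).
Qed.

Lemma frac_le1 x : frac x <= 1.
Proof. by apply: frac_le => n; exact: partial_frac_le1. Qed.

Lemma frac_shift x : frac x = ((nat_of_ord (x 1))%:R + frac (shift 1 x)) / N%:R.
Proof.
apply/eqP; rewrite eq_le; apply/andP; split.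
  apply: frac_le => -[|n] /=; first by rewrite divr_ge0// addr_ge0// frac_ge0.
  by rewrite ler_pM2r ?invr_gt0// lerD2l.
rewrite ler_pdivrMr// addrC -lerBrDr; apply: frac_le => n.
by rewrite lerBrDr addrC -ler_pdivrMr//; exact: (partial_le_frac n.+1).
Qed.

Lemma frac_eq0 x : (forall i : int, 0 < i -> x i = 0 :> nat) -> frac x = 0.
Proof.
move=> x0; apply/eqP; rewrite eq_le frac_ge0 andbT; apply: frac_le => n.
elim: n x x0 => //= n ih x x0; rewrite x0// add0r pmulr_lle0 ?invr_gt0//.
by apply: ih => i i0; apply: x0; rewrite addr_gt0.
Qed.

Lemma shiftD m n x : shift m (shift n x) = shift (m + n) x.
Proof. by apply/funext => i; rewrite /shift addrA. Qed.

(** [Pi r] is long multiplication by [r]: digit [i] becomes [r * x i] modulo [N] plus the carry from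
    digit [i + 1]. The subtracted term is the carry from digit 1 across the point. *)
Lemma frac_Pi r x : (r %| N)%N ->
  frac (Pi r x) = r%:R * frac x - (x 1 %/ (N %/ r))%N%:R.
Proof.
move=> rN.
(* The error [delta] of the formula is bounded, but a shift multiplies it by [N]. *)
pose delta x := frac (Pi r x) - r%:R * frac x + (x 1 %/ (N %/ r))%N%:R.
suff : delta x = 0 by rewrite /delta; lra.
have deltaE y : N%:R * delta y = delta (shift 1 y).
  rewrite /delta (frac_shift (Pi r y)) (frac_shift y).
  have -> : shift 1 (Pi r y) = Pi r (shift 1 y) by [].
  have := val_mul_rule (y 1) (y (1 + 1)) (ltnW N_gt1) rN.
  rewrite -/(Pi r y 1) => ->.
  have N0 := codivisor_gt0 (ltnW N_gt1) rN.
  have NE : N%:R = (N %/ r)%:R * r%:R :> R by rewrite -natrM divnK.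
  have y1E : (nat_of_ord (y 1))%:R =
      (y 1 %/ (N %/ r))%:R * (N %/ r)%:R + (y 1 %% (N %/ r))%:R :> R.
    by rewrite -natrM -natrD -divn_eq.
  rewrite /shift !natrD !natrM y1E NE; field.
  by rewrite !pnatr_eq0 -!lt0n N0 (dvdn_gt0 (ltnW N_gt1) rN).
have deltaX y k : N%:R ^+ k * delta y = delta (shift k%:Z y).
  elim: k y => [|k ih] y.
    rewrite expr0 mul1r; congr delta; apply/funext => i.
    by rewrite /shift addr0.
  by rewrite exprSr -mulrA deltaE ih shiftD -PoszD addn1.
have delta_le y : `|delta y| <= r%:R + N%:R + 1.
  rewrite /delta.
  have := frac_ge0 (Pi r y); have := frac_le1 (Pi r y).
  have := frac_ge0 y; have := frac_le1 y.
  have : (y 1 %/ (N %/ r))%:R <= N%:R :> R.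
    by rewrite ler_nat (leq_trans (leq_div _ _))// ltnW.
  have : 0 <= (y 1 %/ (N %/ r))%:R :> R by [].
  have : 0 <= r%:R :> R by [].
  rewrite ler_norml; nra.
apply/eqP; apply: contraT => d0.
have C0 : 0 <= (r%:R + N%:R + 1) / `|delta x| by rewrite divr_ge0// !addr_ge0.
pose k := Num.bound ((r%:R + N%:R + 1) / `|delta x|).
have := delta_le (shift k%:Z x); rewrite -deltaX.
rewrite normrM -ler_pdivlMr ?normr_gt0//.
rewrite leNgt => /negP[]; apply: lt_trans (archi_boundP C0) _.
by rewrite ger0_norm ?exprn_ge0// -natrX ltr_nat ltn_expl.
Qed.

End FractionalValue.

(** * Expansions of reals, and automata as multiplications *)

Section Represents.
Context {R : realType} {N : nat} (N_gt1 : (1 < N)%N).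
Implicit Types (x : config N) (v : R).
Local Notation frac := (@fractional_value R N).

Let N_gt0 : 0 < N%:R :> R. Proof. by rewrite ltr0n (ltn_trans _ N_gt1). Qed.

(* [x] is a base-[N] expansion of the real [v >= 0], with units digit [x 0]; the
   digits left of the point are scaled in by shifting the expansion. *)
Definition represents x v := exists2 M : nat,
  forall i : int, i <= - M%:Z -> x i = 0 :> nat &
  v = N%:R ^+ M * frac (shift (- M%:Z) x).

(** Including one more leading zero does not change the value, so [M] may be enlarged freely in
    [represents]. *)
Lemma represents_widen x M : x (- M%:Z) = 0 :> nat ->
  N%:R ^+ M.+1 * frac (shift (- M.+1%:Z) x) =
  N%:R ^+ M * frac (shift (- M%:Z) x).
Proof.
move=> x0; rewrite frac_shift// shiftD {1}/shift.
have -> : 1 - M.+1%:Z = - M%:Z by lia.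
by rewrite x0 add0r exprS; field; rewrite gt_eqF.
Qed.

Lemma represents_shift x v : represents x v ->
  represents (shift (- 1) x) (v / N%:R).
Proof.
case=> M xM ->; exists M => [i iM|]; first by rewrite /shift xM//; lia.
rewrite -represents_widen ?xM// shiftD.
have -> : - M%:Z + - 1 = - M.+1%:Z by lia.
by rewrite exprS; field; rewrite gt_eqF.
Qed.

Lemma represents_Pi r x v : (r %| N)%N -> represents x v ->
  represents (Pi r x) (r%:R * v).
Proof.
(* A carry can make the product start one place further left. With the point moved that far, the
   digit next to it is zero and nothing is carried across. *)
move=> rN [M xM ->]; exists M.+1 => [i iM|].
  rewrite val_mul_rule// ?(ltnW N_gt1)//.
  by rewrite !xM ?mod0n ?div0n ?mul0n//; lia.
have -> : shift (- M.+1%:Z) (Pi r x) = Pi r (shift (- M.+1%:Z) x).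
  by apply/funext => i; rewrite /Pi /shift addrAC.
rewrite frac_Pi//.
have -> : shift (- M.+1%:Z) x 1 = x (- M%:Z).
  by rewrite /shift; congr x; lia.
by rewrite xM// div0n subr0 [RHS]mulrCA represents_widen// xM.
Qed.

(** [Pi_inv r] is [Pi (N %/ r)] followed by a shift, that is, multiplication by [N / r] and division
    by [N]. *)
Lemma represents_Pi_inv r x v : (r %| N)%N -> represents x v ->
  represents (Pi_inv r x) (v / r%:R).
Proof.
move=> rN xv; rewrite Pi_invE// ?(ltnW N_gt1)//.
have r0 : r%:R != 0 :> R by rewrite pnatr_eq0 -lt0n (dvdn_gt0 (ltnW N_gt1) rN).
have qN : (N %/ r %| N)%N by exact: dvdn_div.
have := represents_shift (represents_Pi qN xv).
congr represents; rewrite -[in X in _ / X](divnK rN) natrM.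
by field; rewrite r0 pnatr_eq0 -lt0n codivisor_gt0// ltnW.
Qed.

(** The finitely many digits between the leading zeros and the point contribute an integer. *)
Lemma represents_frac x v : represents x v ->
  exists z : int, v = frac x + z%:~R.
Proof.
case=> M _ ->; elim: M => [|M [z zE]].
  exists 0; rewrite expr0 mul1r addr0; congr frac.
  by apply/funext => i; rewrite /shift oppr0 addr0.
exists ((N ^ M * x (- M%:Z))%N%:Z + z).
rewrite frac_shift// shiftD {1}/shift.
have -> : 1 - M.+1%:Z = - M%:Z by lia.
rewrite rmorphD/= [_ + z%:~R]addrC addrA -zE -pmulrn natrM natrX exprS.
by field; rewrite gt_eqF.
Qed.

Definition one_config : config N :=
  fun i => if i == 0 then Ordinal N_gt1 else Ordinal (ltnW N_gt1).

Lemma frac_one : frac one_config = 0.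
Proof. by apply: frac_eq0 => // i i0; rewrite /one_config gt_eqF. Qed.

Lemma represents_one : represents one_config 1.
Proof.
exists 1%N => [i i1|]; first by rewrite /one_config ifF//; lia.
rewrite frac_shift// shiftD addrN.
have -> : shift 0 one_config = one_config.
  by apply/funext => i; rewrite /shift addr0.
rewrite frac_one addr0 /shift addrN /one_config eqxx /=.
by field; rewrite gt_eqF.
Qed.

(* [F], with inverse [G], acts on reals as the multiplication by [a / b]. *)
Record multiplier (F G : config N -> config N) (a b : nat) : Prop :=
    Multiplier {
  mult_num_gt0 : (0 < a)%N;
  mult_den_gt0 : (0 < b)%N;
  mult_cancel : cancel F G;
  mult_cancel_inv : cancel G F;
  mult_continuous : continuous F;
  mult_continuous_inv : continuous G;
  mult_frac : exists2 s : config N -> int,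
    forall x : config N, \forall y \near x, s y = s x &
    forall x, b%:R * frac (F x) = a%:R * frac x + (s x)%:~R;
  mult_represents : forall x v, represents x v ->
    represents (F x) (a%:R / b%:R * v);
  mult_represents_inv : forall x v, represents x v ->
    represents (G x) (b%:R / a%:R * v) }.

Lemma multiplier_inv F G a b : multiplier F G a b -> multiplier G F b a.
Proof.
case=> a0 b0 FG GF cF cG [s sl sE] Fv Gv; split=> //.
exists (fun x => - s (G x)) => x.
  have sG : \forall y \near x, s (G y) = s (G x).
    exact: (cG x [set y | s y = s (G x)] (sl (G x))).
  by apply: filterS sG => y ->.
by have := sE (G x); rewrite GF rmorphN /=; lra.
Qed.

Lemma multiplier_comp F1 G1 a1 b1 F2 G2 a2 b2 :
  multiplier F1 G1 a1 b1 -> multiplier F2 G2 a2 b2 ->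
  multiplier (F2 \o F1) (G1 \o G2) (a2 * a1) (b2 * b1).
Proof.
case=> a10 b10 FG1 GF1 cF1 cG1 [s1 sl1 sE1] Fv1 Gv1.
case=> a20 b20 FG2 GF2 cF2 cG2 [s2 sl2 sE2] Fv2 Gv2; split.
- by rewrite muln_gt0 a20.
- by rewrite muln_gt0 b20.
- exact: can_comp.
- exact: can_comp.
- by move=> x; apply: continuous_comp; [exact: cF1|exact: cF2].
- by move=> x; apply: continuous_comp; [exact: cG2|exact: cG1].
- exists (fun x => a2%:Z * s1 x + b1%:Z * s2 (F1 x)) => x.
    have sF1 : \forall y \near x, s2 (F1 y) = s2 (F1 x).
      exact: (cF1 x [set y | s2 y = s2 (F1 x)] (sl2 (F1 x))).
    by apply: filterS2 (sl1 x) sF1 => y -> ->.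
  rewrite !natrM /= [b2%:R * _]mulrC -!mulrA sE2 rmorphD /= !rmorphM /=.
  by rewrite mulrDr mulrCA sE1 -!pmulrn; ring.
- move=> x v /Fv1/Fv2; congr represents; rewrite !natrM; field.
  by rewrite !pnatr_eq0 -!lt0n b10 b20.
- move=> x v /Gv2/Gv1; congr represents; rewrite !natrM; field.
  by rewrite !pnatr_eq0 -!lt0n a10 a20.
Qed.

Lemma multiplier_id : multiplier id id 1 1.
Proof.
split=> //; try by move=> x; exact: cvg_id.
- exists (fun=> 0) => x; last by rewrite addr0.
  by apply: filterS filterT.
- by move=> x v; rewrite divff ?oner_eq0// mul1r.
- by move=> x v; rewrite divff ?oner_eq0// mul1r.
Qed.

Lemma multiplier_Pi r : (r %| N)%N -> multiplier (@Pi r N) (@Pi_inv r N) r 1.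
Proof.
move=> rN; have N0 := ltnW N_gt1; have [FG GF] := Pi_bijective N0 rN.
split=> //.
- exact: dvdn_gt0 rN.
- exact: Pi_continuous.
- exact: Pi_inv_continuous.
- exists (fun x => - (x 1 %/ (N %/ r))%N%:Z) => x.
    by apply: filterS (prod_nbhs1 x 1) => y /= ->.
  by rewrite mul1r frac_Pi// rmorphN /= -pmulrn.
- by move=> x v /(represents_Pi rN); rewrite divr1.
- by move=> x v /(represents_Pi_inv rN); rewrite mul1r mulrC.
Qed.

(** Here [a] and [b] are the products of the divisors in the given decomposition. The fraction
    [a / b] need not be reduced, so it is tied to [p / q] by cross multiplication only. *)
Lemma is_Pi_multiplier (p q : nat) T : (0 < q)%N ->
  is_Pi (p%:R / q%:R) T -> exists G a b,
    multiplier T G a b /\ (p * b = q * a)%N.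
Proof.
move=> q0 [ps [qs [+ pqE ->]]]; rewrite all_cat => /andP[psN qsN].
set a := (\prod_(r <- ps) r)%N in pqE; set b := (\prod_(r <- qs) r)%N in pqE.
suff [G FG] : exists G, multiplier
    (foldr (fun r f => @Pi r N \o f)
      (foldr (fun r f => @Pi_inv r N \o f) id qs) ps) G a b.
  exists G, a, b; split=> //; apply/eqP; rewrite -(eqr_nat rat) !natrM.
  move: pqE; have b0 := mult_den_gt0 FG => /eqP.
  by rewrite eqr_div ?pnatr_eq0 -?lt0n// mulrC [a%:R * _]mulrC mulrC.
elim: ps psN @a {pqE} => [_|r ps ih] /=; last first.
  case/andP=> /andP[_ rN] /ih[G FG]; rewrite big_cons -[b]mul1n.
  by eexists; exact: multiplier_comp FG (multiplier_Pi rN).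
rewrite big_nil; elim: qs qsN @b => [_|r qs ih] /=.
  by rewrite big_nil; exists id; exact: multiplier_id.
case/andP=> /andP[_ rN] /ih[G FG]; rewrite big_cons.
exists (G \o @Pi r N); rewrite -[X in multiplier _ _ X _]mul1n.
exact: multiplier_comp FG (multiplier_inv (multiplier_Pi rN)).
Qed.

End Represents.

(** * Splicing orbits *)

Lemma iter_cancel (X : Type) (F G : X -> X) n :
  cancel F G -> cancel (iter n F) (iter n G).
Proof. by move=> FG; elim: n => // n ih x; rewrite iterSr iterS FG ih. Qed.

Lemma expn_dominates (a b C : nat) : (0 < a < b)%N ->
  exists n, (C * a ^ n < b ^ n)%N.
Proof.
case/andP=> a0 ab; exists (a * C)%N.
(* Bernoulli's inequality [(b / a) ^ n >= 1 + n / a], cleared of denominators; at [n = a * C] the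
   right side is [1 + C]. *)
have bern n : ((n + a) * a ^ n <= a * b ^ n)%N.
  elim: n => [|n ih]; first by rewrite add0n !expn0.
  rewrite !expnS [leqRHS]mulnCA.
  apply: (@leq_trans (a.+1 * ((n + a) * a ^ n))); last exact: leq_mul.
  by rewrite mulnCA mulnA [leqRHS]mulnA leq_mul2r; apply/orP; right; nia.
rewrite -(ltn_pmul2l a0); apply: leq_trans (bern _).
by rewrite mulnA ltn_pmul2r ?expn_gt0 ?a0//; lia.
Qed.

(** If the difference were an integer, multiplying by [q ^ j] would make [q] divide [p ^ j], because
    [i < j]; but [q > 1] is coprime to it. *)
Lemma expr_ratio_sub_notin_int (R : realType) (p q i j : nat) :
  coprime p q -> (1 < q)%N -> (i < j)%N ->
  forall z : int, (p%:R / q%:R) ^+ i - (p%:R / q%:R) ^+ j != z%:~R :> R.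
Proof.
move=> pq q1 ij z; apply/negP => /eqP zE.
have q0 : q%:R != 0 :> R by rewrite pnatr_eq0; lia.
have zqE : ((p ^ i * q ^ (j - i))%N%:Z = z * (q ^ j)%N%:Z + (p ^ j)%N%:Z).
  apply: (@intr_inj R); rewrite rmorphD rmorphM /= -zE -!pmulrn !natrM !natrX.
  have qj : q%:R ^+ j = q%:R ^+ i * q%:R ^+ (j - i) :> R.
    by rewrite -exprD (subnKC (ltnW ij)).
  rewrite !expr_div_n qj; field.
  by rewrite !expf_neq0.
have : (q %| p ^ j)%N.
  have -> : (q %| p ^ j)%N = (q%:Z %| (p ^ j)%N%:Z)%Z by [].
  have -> : ((p ^ j)%N%:Z = (p ^ i * q ^ (j - i))%N%:Z - z * (q ^ j)%N%:Z).
    by rewrite zqE; ring.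
  rewrite rpredB//.
    rewrite PoszM dvdz_mull// -(subnSK ij) expnS PoszM dvdz_mulr//.
  by rewrite dvdz_mull// -(ltn_predK ij) expnS PoszM dvdz_mulr.
by move: (coprimeXl j pq); rewrite /coprime => /eqP g /gcdn_idPr; lia.
Qed.

(** * Codes, shadowing points and the orbit of the number 1 *)

Section Expansion.
Context {R : realType} {N : nat} (N_gt1 : (1 < N)%N).
Context (F G : config N -> config N) (a b : nat).
Context (FG : @multiplier R N F G a b).
Implicit Types x y z : config N.
Local Notation frac := (@fractional_value R N).
Local Notation e := (one_config N_gt1).

(** The integer [s x = b * frac (F x) - a * frac x] lies between [-a] and [b], so, increased by [a],
    it is a symbol of a finite alphabet. Equal symbols cancel in the difference of two such
    equations. *)
Lemma multiplier_code : exists (A : finType) (c : config N -> A),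
  (forall x : config N, \forall y \near x, c y = c x) /\
  forall x y, c x = c y ->
    b%:R * (frac (F x) - frac (F y)) = a%:R * (frac x - frac y).
Proof.
have [s sl sE] := mult_frac FG.
have s_bound x : (0 <= s x + a%:Z <= (a + b)%N%:Z)%R.
  have : 0 <= a%:R * frac x <= a%:R.
    by rewrite mulr_ge0 ?frac_ge0//= ler_piMr// frac_le1.
  have : 0 <= b%:R * frac (F x) <= b%:R.
    by rewrite mulr_ge0 ?frac_ge0//= ler_piMr// frac_le1.
  rewrite sE -(ler_int R) -(ler_int R (s x + a%:Z)%R) rmorphD /= -!pmulrn natrD.
  lra.
exists 'I_(a + b).+1, (fun x => inord `|(s x + a%:Z)%R|%N); split.
  by move=> x; apply: filterS (sl x) => y ->.
move=> x y /(congr1 (@nat_of_ord _)).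
have := s_bound x; have := s_bound y => sy sx.
rewrite !inordK; [move=> sxy|lia|lia].
have {}sxy : s x = s y by lia.
by have := sE x; have := sE y; rewrite sxy; lra.
Qed.

(* All that is used of a point [z] whose codes agree with those of [x] before
   time [n] and with those of [y] from time [n] on. *)
Definition shadows n z x y :=
  (forall k, (k <= n)%N -> b%:R ^+ k * (frac (iter k F z) - frac (iter k F x)) =
     a%:R ^+ k * (frac z - frac x)) /\
  (forall k, b%:R ^+ k * (frac (iter (k + n) F z) - frac (iter (k + n) F y)) =
     a%:R ^+ k * (frac (iter n F z) - frac (iter n F y))).

Lemma shadows_splice (A : finType) (c : config N -> A) n z x y
    (cP : forall x y, c x = c y ->
      b%:R * (frac (F x) - frac (F y)) = a%:R * (frac x - frac y)) :
  (forall k, c (iter k F z) =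
     if (k < n)%N then c (iter k F x) else c (iter k F y)) ->
  shadows n z x y.
Proof.
move=> cz; split=> [k|k].
  elim: k => [|k ih] kn; first by rewrite !expr0 !mul1r.
  by rewrite !iterS !exprS mulrAC cP ?cz ?kn// mulrAC -!mulrA ih// ltnW.
elim: k => [|k ih]; first by rewrite !expr0 !mul1r.
rewrite addSn !iterS !exprS mulrAC cP; first by rewrite mulrAC -!mulrA ih.
by rewrite cz ltnNge leq_addl.
Qed.

Let frac_bounds x : 0 <= frac x <= 1.
Proof. by rewrite frac_ge0 ?frac_le1. Qed.

Let a0 : 0 < a%:R :> R. Proof. by rewrite ltr0n (mult_num_gt0 FG). Qed.
Let b0 : 0 < b%:R :> R. Proof. by rewrite ltr0n (mult_den_gt0 FG). Qed.

(** The comparison before the cut is possible because [i <= n]: the point whose past [z] shares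
    reaches [e] at time [n - i]. *)
Lemma expanding_shadows n z i y : (b < a)%N -> (i <= n)%N ->
  shadows n z (iter n G (iter i F e)) (iter n G y) ->
  frac (iter i F e) <= frac y.
Proof.
have FnG k := iter_cancel k (mult_cancel FG).
have GnF k := iter_cancel k (mult_cancel_inv FG).
move=> ba lein [zx zy].
have xE : iter (n - i) F (iter n G (iter i F e)) = e.
  by rewrite -{2}(subnK lein) iterD FnG GnF.
(* The error at time [n - i] is nonnegative since [frac e = 0], and multiplication by powers of
   [a / b] preserves its sign, back to time 0 and then on to the cut. *)
have ge_x : frac (iter n G (iter i F e)) <= frac z.
  rewrite -subr_ge0 -(pmulr_rge0 _ (exprn_gt0 (n - i) a0)) -zx ?leq_subr//.
  by rewrite xE frac_one subr0 mulr_ge0 ?exprn_ge0 ?frac_ge0// ltW.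
have ge_xn : frac (iter i F e) <= frac (iter n F z).
  rewrite -subr_ge0 -(pmulr_rge0 _ (exprn_gt0 n b0)).
  rewrite -{1}(GnF n (iter i F e)) zx//.
  by rewrite mulr_ge0 ?exprn_ge0 ?subr_ge0// ltW.
(* A nonzero error at the cut would grow like [(a / b) ^ k] afterwards, while differences of values
   are at most 1. *)
suff <- : frac (iter n F z) = frac y by [].
apply/eqP; rewrite -subr_eq0; apply: contraT => d0.
have bounded k : a%:R ^+ k * `|frac (iter n F z) - frac y| <= b%:R ^+ k.
  rewrite -[X in X * _]ger0_norm ?exprn_ge0 ?(ltW a0)// -normrM.
  have := zy k; rewrite GnF => <-.
  rewrite normrM ger0_norm ?exprn_ge0 ?(ltW b0)//.
  rewrite ler_piMr ?exprn_ge0 ?(ltW b0)//.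
  have := frac_bounds (iter (k + n) F z).
  have := frac_bounds (iter (k + n) F (iter n G y)).
  by rewrite ler_norml; lra.
have ab : (0 < b < a)%N by rewrite ba (mult_den_gt0 FG).
have dV0 : 0 <= `|frac (iter n F z) - frac y|^-1 by rewrite invr_ge0.
have [k] := expn_dominates (Num.bound `|frac (iter n F z) - frac y|^-1) ab.
rewrite ltnNge => /negP[]; rewrite -(ler_nat R) natrM !natrX.
move: (bounded k); rewrite -ler_pdivlMr ?normr_gt0// => /le_trans; apply.
rewrite mulrC ler_wpM2r ?exprn_ge0 ?(ltW b0)//.
exact/ltW/archi_boundP.
Qed.

(** The value of [z] at the cut is at least that of the point with the same future, which reaches
    [e], of value 0, after [j] more steps. It exceeds that of the point with the same past by at
    most [(a / b) ^ n], as the initial error is at most 1. *)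
Lemma contracting_shadows n z i j :
  shadows n z (iter n G (iter i G e)) (iter n G (iter j G e)) ->
  b%:R ^+ n * (frac (iter j G e) - frac (iter i G e)) <= a%:R ^+ n.
Proof.
have GnF k := iter_cancel k (mult_cancel_inv FG).
move=> [/(_ n (leqnn n)) zx /(_ j)].
rewrite !iterD !GnF frac_one subr0 => zy.
have ge_y : frac (iter j G e) <= frac (iter n F z).
  rewrite -subr_ge0 -(pmulr_rge0 _ (exprn_gt0 j a0)) -zy.
  by rewrite mulr_ge0 ?exprn_ge0 ?frac_ge0// ltW.
apply: (@le_trans _ _ (a%:R ^+ n * (frac z - frac (iter n G (iter i G e))))).
  by rewrite -zx GnF ler_pM2l ?exprn_gt0// lerB.
rewrite ler_piMr ?exprn_ge0 ?(ltW a0)//.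
have := frac_bounds z; have := frac_bounds (iter n G (iter i G e)); lra.
Qed.

Lemma represents_iter k x (v : R) :
  represents x v -> represents (iter k F x) ((a%:R / b%:R) ^+ k * v).
Proof.
move=> xv; elim: k => [|k /(mult_represents FG)]; first by rewrite expr0 mul1r.
by rewrite exprS mulrA.
Qed.

Lemma frac_iter_one k :
  exists z : int, frac (iter k F e) = (a%:R / b%:R) ^+ k + z%:~R.
Proof.
have [z zE] := represents_frac N_gt1 (represents_iter k (represents_one N_gt1)).
by exists (- z); rewrite rmorphN /= -[X in X - _]mulr1 zE addrK.
Qed.

End Expansion.

Lemma is_Pi_unary (p q : nat) T : (0 < q)%N ->
  @is_Pi (p%:R / q%:R) 1 T -> p = q.
Proof.
move=> q0 [ps [qs [+ pqE _]]].
have prod1 rs : all (fun r => (0 < r)%N && (r %| 1)%N) rs ->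
    (\prod_(r <- rs) r = 1)%N.
  elim: rs => [|r rs ih] /=; first by rewrite big_nil.
  by rewrite dvdn1 => /andP[/andP[_ /eqP->] /ih]; rewrite big_cons mul1n.
rewrite all_cat => /andP[/prod1 psE /prod1 qsE].
move: pqE; rewrite psE qsE divr1 => /divr1_eq/eqP.
by rewrite eqr_nat => /eqP.
Qed.

(** * Contradiction in the expanding and in the contracting case *)

Theorem theorem5p17 (N p q : nat) (T : config N -> config N)
    (N_gt0 : (0 < N)%N) (p_gt2 : (2 < p)%N) (q_gt2 : (2 < q)%N)
    (pq_coprime : coprime p q)
    (T_Pi : is_Pi (p%:R / q%:R)%R T) :
  ~ regular (Pi_system N_gt0 T_Pi).
Proof.
have q_gt0 : (0 < q)%N by exact: leq_trans q_gt2.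
move=> reg.
have N_gt1 : (1 < N)%N.
  rewrite ltn_neqAle N_gt0 andbT; apply/eqP => N1.
  move: T T_Pi pq_coprime {reg}; rewrite -N1 => T1 /(is_Pi_unary q_gt0) ->.
  by rewrite /coprime gcdnn; lia.
pose R : realType := Rdefinitions.R.
have [G [a [b [TG pqE]]]] := @is_Pi_multiplier R N N_gt1 p q T q_gt0 T_Pi.
have [A [c [cl cP]]] := multiplier_code N_gt1 TG.
have [Y YX Ytr] := @trace_subshift (Pi_system N_gt0 T_Pi) A c cl.
(* Starting from [iter n G (x i)] makes the orbit pass through [x i] at the cut. Spliced traces lie
   in [Y], so they are traces of actual configurations [z]. *)
have [K shadowK] : exists K, forall n (x : nat -> config N), exists i j,
    [/\ (i < j <= K)%N,
      exists z, @shadows R N T a b n z (iter n G (x i)) (iter n G (x j)) &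
      exists z, @shadows R N T a b n z (iter n G (x j)) (iter n G (x i))].
  have [K KP] := sofic_splice (reg A Y YX); exists K => n x.
  have shadowsP u v : points Y (splice n (trace (X := Pi_system N_gt0 T_Pi) c u)
      (trace (X := Pi_system N_gt0 T_Pi) c v)) ->
      exists z, @shadows R N T a b n z u v.
    rewrite Ytr => -[z _ zuv]; exists z; apply: shadows_splice cP _ => k.
    exact: (congr1 (fun y : fullshift A => y k) zuv).
  have [|i [j [ij /shadowsP si /shadowsP sj]]] :=
    KP n (fun i => trace (X := Pi_system N_gt0 T_Pi) c (iter n G (x i))).
    by move=> i; rewrite Ytr; eexists.
  by exists i, j.
have ab0 := mult_num_gt0 TG; have bb0 := mult_den_gt0 TG.
have pqab : p%:R / q%:R = a%:R / b%:R :> R.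
  apply/eqP; rewrite eqr_div ?pnatr_eq0 -?lt0n// -!natrM pqE.
  by rewrite mulnC.
pose e := one_config N_gt1.
case: (ltngtP a b) => ab; last first.
- move: pqE pq_coprime; rewrite ab /coprime => /eqP.
  by rewrite eqn_pmul2r// => /eqP->; rewrite gcdnn; lia.
(* Cutting at time [K] ensures that both indices are at most the cut time. The two exchanges then
   give opposite inequalities, hence equal values. *)
- have [i [j [/andP[ij jK] [z zij] [z' zji]]]] :=
    shadowK K (fun i => iter i T e).
  have iK : (i <= K)%N by exact: leq_trans (ltnW ij) jK.
  have le1 := expanding_shadows TG ab iK zij.
  have le2 := expanding_shadows TG ab jK zji.
  have [zi ziE] := frac_iter_one N_gt1 TG i.
  have [zj zjE] := frac_iter_one N_gt1 TG j.
  have := expr_ratio_sub_notin_int R pq_coprime (ltnW q_gt2) ij (zj - zi).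
  rewrite pqab rmorphB /= => /eqP; apply; lra.
- have ab' : (0 < a < b)%N by rewrite ab0.
  (* The cut is so late that the error bound [(a / b) ^ n] is below [a ^ -K], where [a ^ K] is a
     common denominator of all [(b / a) ^ k] with [k <= K]. *)
  have [n nP] := expn_dominates (a ^ K) ab'.
  have [i [j [/andP[ij jK] [z zij] [z' zji]]]] :=
    shadowK n (fun i => iter i G e).
  have le1 := contracting_shadows TG zij.
  have le2 := contracting_shadows TG zji.
  have [zi ziE] := frac_iter_one N_gt1 (multiplier_inv TG) i.
  have [zj zjE] := frac_iter_one N_gt1 (multiplier_inv TG) j.
  (* The difference of the two values at the cut, multiplied by [a ^ K], is this integer. It is
     nonzero by coprimality, yet the two exchanges force its absolute value below 1. *)
  pose w : int := ((b ^ i * a ^ (K - i))%N%:Z - (b ^ j * a ^ (K - j))%N%:Z +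
    (a ^ K)%N%:Z * (zi - zj))%R.
  have aK k : (k <= K)%N -> a%:R ^+ K = a%:R ^+ k * a%:R ^+ (K - k) :> R.
    by move=> kK; rewrite -exprD subnKC.
  have iK : (i <= K)%N by exact: leq_trans (ltnW ij) jK.
  have a_neq0 : a%:R != 0 :> R by rewrite pnatr_eq0 -lt0n.
  have wE : w%:~R = a%:R ^+ K *
      (fractional_value (iter i G e) - fractional_value (iter j G e)) :> R.
    rewrite ziE zjE /w rmorphD rmorphB rmorphM rmorphB /= -!pmulrn !natrM !natrX.
    rewrite opprD addrACA.
    rewrite [RHS]mulrDr [X in _ = X + _]mulrBr {2}(aK i iK) {2}(aK j jK).
    rewrite !expr_div_n; congr (_ - _ + _).
      by field; rewrite expf_neq0.
    by field; rewrite expf_neq0.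
  have w0 : w != 0.
    apply/eqP => w0; move: wE; rewrite w0 => /esym/eqP.
    rewrite mulf_eq0 expf_eq0 (negPf a_neq0) andbF /= subr_eq0 => /eqP eij.
    have p_gt1 : (1 < p)%N by exact: ltnW.
    have qp : coprime q p by rewrite coprime_sym.
    have /eqP[] := expr_ratio_sub_notin_int R qp p_gt1 ij (zj - zi).
    have -> : q%:R / p%:R = b%:R / a%:R :> R by rewrite -invf_div pqab invf_div.
    by rewrite rmorphB /=; move: eij; rewrite ziE zjE; lra.
  have : 1 <= `|w%:~R| :> R by rewrite -intr_norm ler1z; lia.
  rewrite wE normrM ger0_norm ?exprn_ge0// => w1.
  move: nP; rewrite ltnNge => /negP[]; rewrite -(ler_nat R) natrM !natrX.
  have bn : 0 < b%:R ^+ n :> R by rewrite exprn_gt0// ltr0n.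
  rewrite -(ler_pM2l bn) mulr1 in w1; apply: le_trans w1 _.
  rewrite mulrCA ler_wpM2l ?exprn_ge0//.
  rewrite -[X in X * _ <= _]ger0_norm ?(ltW bn)// -normrM ler_norml.
  by rewrite lerNl -mulrN opprB le1 le2.
Qed.
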